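(* Let $m=2n+1$ be an odd positive integer (with $n$ a nonnegative integer), and let $r$ be a real number with $0\le r\le \frac{1}{2m}$. Then the multiplication formula $$T(mr) = m\sum_{j=0}^n T\left(\frac{j}{m}+r\right) - m\sum_{j=1}^n T\left(\frac{j}{m}-r\right)$$ holds.
   Context: For real $r$ with $0\le r\le \tfrac12$, $T(r) := \int_0^{r\pi}\log(\tan\theta)\,d\theta$ (the integrand has integrable logarithmic singularities at $0$ and $\pi/2$). Empty sums are $0$. *)

(* Defs.v *)
From HB Require Import structures.
From mathcomp Require Import all_boot all_order all_algebra.
From mathcomp Require Import all_classical all_reals all_analysis.

Set Implicit Arguments.
Unset Strict Implicit.
Unset Printing Implicit Defensive.
Import Order.TTheory GRing.Theory Num.Theory.
Import numFieldNormedType.Exports.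
Local Open Scope classical_set_scope.
Local Open Scope ring_scope.

(* T(r) for 0 <= r <= 1/2, as a Lebesgue integral.  The library's ln and tan
   are total and give ln (tan 0) = ln (tan (pi / 2)) = 0; these conventions
   only affect a null set.  The integrand is Lebesgue integrable on
   [0, pi / 2], so Rintegral, which is fine of the \bar R-valued integral, is
   the integral itself there.  For other r the value is not meaningful. *)
Definition T {R : realType} (r : R) : R :=
  \int[lebesgue_measure]_(theta in `[0, r * pi]) ln (tan theta).

(* Main.v *)
Require Import Defs.
From HB Require Import structures.
From mathcomp Require Import all_boot all_order all_algebra.
From mathcomp Require Import ring lra zify.
From mathcomp Require Import all_classical all_reals all_analysis.
From mathcomp Require Import measurable_realfun.

Set Implicit Arguments.
Unset Strict Implicit.
Unset Printing Implicit Defensive.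
Import Order.TTheory GRing.Theory Num.Theory.
Import numFieldNormedType.Exports.
Local Open Scope classical_set_scope.
Local Open Scope ring_scope.

(** The formula is the logarithm of
      tan (m t) = tan t * prod_(1 <= j <= n) tan (j a + t) tan (j a - t),
    with a = pi / m and m = 2n + 1, integrated from 0 to r pi: for
    0 < t < a / 2 every factor is the tangent of an angle in ]0, pi / 2[, so the
    logarithms add up ([ln_tan_odd_sum]), and the substitutions u = m t,
    u = j a + t and u = j a - t turn the integrals into values of T.  The
    constants T (j / m) that the two shifted substitutions leave cancel.

    The product formula is the quotient of two others.  By de Moivre,
    sin (m t) = sin t * p (sin t ^ 2) with p of degree at most n; the n distinct
    numbers sin (j a) ^ 2 are roots of p, hence p splits over them, and
    sin (j a) ^ 2 - sin t ^ 2 = sin (j a + t) * sin (j a - t)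
    ([sin_odd_prod]).  The reflection of t in pi / 4 gives the same formula for
    the cosine with the same constant ([cos_odd_prod]), so that constant drops
    out of the quotient.

    On the analytic side no substitution under the integral is made.  Instead, a
    primitive V of ln tan is shown to be continuous on [0, pi / 2] and
    differentiable in its interior, and the mean value theorem is applied to
    the difference of the two sides as a function of t = r pi: its derivative
    vanishes and so does its value at 0.  Continuity of V at the two singular
    endpoints comes from the integrability of ln tan ([integrable_ln_tan]),
    for which ln tan is dominated by the derivative of the bounded function
    8 (sqrt (sin x) - sqrt (cos x)). *)

(** * Products over equally spaced angles *)

(** The step from n to n + 1 is the addition formula for m t + 2 t; it mixes
    sine and cosine, which is why both polynomials are built together. *)
Lemma sin_cos_odd_poly (R : realType) (n : nat) : exists p q : {poly R},
  [/\ (size p <= n.+1)%N, (size q <= n.+1)%N &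
   forall t : R, sin ((2 * n + 1)%:R * t) = sin t * p.[sin t ^+ 2] /\
                 cos ((2 * n + 1)%:R * t) = cos t * q.[sin t ^+ 2]].
Proof.
elim: n => [|n [p [q [sp sq pq]]]].
  exists 1, 1; split; rewrite ?size_poly1// => t.
  by rewrite mul1r !hornerE.
(* with x = sin t ^ 2: cos (2 t) = 1 - 2 x and cos t ^ 2 = 1 - x *)
exists ((1 - 'X *+ 2) * p + ((1 - 'X) * q) *+ 2),
       ((1 - 'X *+ 2) * q - ('X * p) *+ 2).
have s1 (d : {poly R}) : (size d <= 2)%N -> forall u : {poly R},
    (size u <= n.+1)%N -> (size (d * u)%R <= n.+2)%N.
  move=> d2 u un; apply: leq_trans (size_polyMleq _ _) _.
  by rewrite -subn1 leq_subLR (leq_trans (leq_add d2 un)).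
have sX : (size ('X : {poly R}) <= 2)%N by rewrite size_polyX.
have s1X2 : (size (1 - 'X *+ 2 : {poly R})%R <= 2)%N.
  apply: leq_trans (size_polyD _ _) _; rewrite size_poly1 size_polyN geq_max/=.
  by rewrite -scaler_nat (leq_trans (size_scale_leq _ _)).
have s1X : (size (1 - 'X : {poly R})%R <= 2)%N.
  by apply: leq_trans (size_polyD _ _) _; rewrite size_poly1 size_polyN geq_max.
have s2 (u v : {poly R}) : (size u <= n.+2)%N -> (size v <= n.+2)%N ->
    (size (u + v *+ 2)%R <= n.+2)%N.
  move=> hu hv; apply: leq_trans (size_polyD _ _) _; rewrite geq_max hu/=.
  by rewrite -scaler_nat (leq_trans (size_scale_leq _ _)).
split.
- by apply: s2; apply: s1.
- rewrite -[- (('X * p) *+ 2)]mulNrn.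
  by apply: s2; rewrite ?size_polyN; apply: s1.
move=> t; have [ps qc] := pq t.
have -> : (2 * n.+1 + 1)%:R * t = (2 * n + 1)%:R * t + t *+ 2.
  by rewrite mulnS -addnA addnC natrD mulrDl [2%:R * t]mulr_natl.
rewrite sinD (cosD (_ * _)) ps qc sin_mulr2n cos_mulr2n cos2sin2.
rewrite !(hornerD, hornerN, hornerM, hornerMn, hornerX, hornerC).
by have c2 := cos2sin2 t; split; ring: c2.
Qed.

Lemma sinD_sinB (R : realType) (a t : R) :
  sin (a + t) * sin (a - t) = sin a ^+ 2 - sin t ^+ 2.
Proof.
rewrite sinD sinB.
have ca := cos2sin2 a; have ct := cos2sin2 t; ring: ca ct.
Qed.

(** The polynomial of [sin_cos_odd_poly] has as many distinct roots as its
    degree allows: sin (m t) vanishes at t = j a although sin t does not, and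
    the sine is injective on [0, pi / 2].  The constant c is in fact 4 ^ n;
    only its being nonzero matters, since it cancels in the tangent. *)
Lemma sin_odd_prod (R : realType) (n : nat) (a := pi / (2 * n + 1)%:R) :
  exists2 c : R, c != 0 & forall t : R, sin ((2 * n + 1)%:R * t) =
    c * sin t * \prod_(1 <= j < n.+1) (sin (j%:R * a + t) * sin (j%:R * a - t)).
Proof.
have [p [q [sp _ pq]]] := sin_cos_odd_poly R n.
have m0 : 0 < (2 * n + 1)%:R :> R by rewrite ltr0n addn1.
have a0 : 0 < a by rewrite divr_gt0// pi_gt0.
have ma : (2 * n + 1)%:R * a = pi by rewrite mulrC divfK// gt_eqF.
have ja j : (1 <= j <= n)%N -> 0 < j%:R * a < pi / 2.
  move=> /andP[j1 jn]; rewrite mulr_gt0 ?ltr0n//= ltr_pdivlMr//.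
  by rewrite -ma -mulrA mulrCA [X in _ < X]mulrC ltr_pM2l// -natrM ltr_nat mulnC; lia.
have s0 j : (1 <= j <= n)%N -> 0 < sin (j%:R * a).
  by move=> /ja/sin_gt0_pihalf.
have sinpin j : sin (j%:R * pi) = 0 :> R.
  have := alternatingn (@sinDpi R) j 0.
  by rewrite sin0 mulr0 add0r => <-; rewrite mulr_natl.
have jn j : (j \in index_iota 1 n.+1) = (1 <= j <= n)%N by rewrite mem_index_iota.
pose rs := [seq sin (j%:R * a) ^+ 2 | j <- index_iota 1 n.+1].
have rsz : size rs = n by rewrite size_map size_iota subn1.
have rsr : all (root p) rs.
  apply/allP => _ /mapP[j + ->]; rewrite jn => jle.
  have [+ _] := pq (j%:R * a).
  rewrite mulrCA ma sinpin => /esym/eqP; rewrite mulf_eq0 gt_eqF ?s0//=.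
have rsu : uniq rs.
  rewrite map_inj_in_uniq ?iota_uniq// => i j; rewrite !jn => hi hj /eqP.
  rewrite eqrXn2 ?(ltW (s0 _ _))// => /eqP/sin_inj.
  move: (ja _ hi) (ja _ hj) => /andP[i0 i1] /andP[j0 j1].
  have pih : - (pi / 2) < 0 :> R by rewrite oppr_lt0 divr_gt0// pi_gt0.
  rewrite !in_itv/= !ltW ?(lt_trans pih)// => /(_ isT isT)/mulIf.
  by rewrite gt_eqF// => /(_ isT)/eqP; rewrite eqr_nat => /eqP.
(* p cannot vanish, because sin (m t) = 1 at t = a / 2 *)
have p0 : p != 0.
  apply/eqP => p0; have [+ _] := pq (a / 2).
  rewrite mulrA ma sin_pihalf p0 horner0 mulr0 => /eqP.
  by rewrite oner_eq0.
have szp : size p = (size rs).+1.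
  by apply/eqP; rewrite eqn_leq {1}rsz sp max_poly_roots.
exists (lead_coef p * (-1) ^+ n).
  by rewrite mulf_neq0 ?lead_coef_eq0 ?signr_eq0.
move=> t; have [-> _] := pq t.
rewrite [in LHS](all_roots_prod_XsubC szp rsr) ?uniq_rootsE//.
rewrite hornerZ horner_prod big_map mulrCA -!mulrA; congr (_ * _).
rewrite mulrCA; congr (_ * _).
have -> : (-1) ^+ n = \prod_(1 <= j < n.+1) (-1) :> R.
  by rewrite prodr_const_nat subn1.
rewrite -big_split/=; apply: eq_bigr => j _.
by rewrite sinD_sinB hornerXsubC mulN1r opprB.
Qed.

(** Replacing t by pi / 2 - t exchanges sine and cosine; the sign (-1) ^ n of
    sin (m pi / 2 - m t) is matched by one sign for each of the n factors. *)
Lemma cos_odd_prod (R : realType) (n : nat) (a := pi / (2 * n + 1)%:R) (c : R) :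
  (forall t : R, sin ((2 * n + 1)%:R * t) =
    c * sin t * \prod_(1 <= j < n.+1) (sin (j%:R * a + t) * sin (j%:R * a - t))) ->
  forall t : R, cos ((2 * n + 1)%:R * t) =
    c * cos t * \prod_(1 <= j < n.+1) (cos (j%:R * a + t) * cos (j%:R * a - t)).
Proof.
have sinB2 (x : R) : sin (pi / 2 - x) = cos x.
  by rewrite sinB sin_pihalf cos_pihalf mul0r subr0 mul1r.
move=> hs t; have := hs (pi / 2 - t).
have -> : (2 * n + 1)%:R * (pi / 2 - t) = (pi / 2 - (2 * n + 1)%:R * t) + pi *+ n.
  by rewrite -[pi *+ n]mulr_natr natrD natrM; field.
rewrite (alternatingn (@sinDpi R)) !sinB2 => hm.
have sg0 : (-1) ^+ n != 0 :> R by rewrite signr_eq0.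
apply: (mulfI sg0); rewrite hm mulrCA -!mulrA; congr (_ * (_ * _)).
have -> : (-1) ^+ n = \prod_(1 <= j < n.+1) (-1) :> R.
  by rewrite prodr_const_nat subn1.
rewrite -big_split/=; apply: eq_bigr => j _.
have -> : j%:R * a + (pi / 2 - t) = pi / 2 - (t - j%:R * a) by ring.
have -> : j%:R * a - (pi / 2 - t) = - (pi / 2 - (j%:R * a + t)) by ring.
by rewrite sinN !sinB2 -[cos (t - _)]cosN opprB; ring.
Qed.

Lemma sin_cos_gt0 (R : realType) (x : R) :
  0 < x < pi / 2 -> 0 < sin x /\ 0 < cos x.
Proof.
move=> x0p; split; first exact: sin_gt0_pihalf.
apply: cos_gt0_pihalf; case/andP: x0p => x0 ->.
by rewrite (lt_trans _ x0)// oppr_lt0 divr_gt0// pi_gt0.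
Qed.

Lemma tan_gt0_pihalf (R : realType) (x : R) : 0 < x < pi / 2 -> 0 < tan x.
Proof. by move=> /sin_cos_gt0[s0 c0]; rewrite divr_gt0. Qed.

(** Since n a = pi / 2 - a / 2, these bounds keep j a + t and j a - t inside
    [0, pi / 2] for t between 0 and a / 2. *)
Lemma odd_step_bounds (R : realType) (n j : nat) (a : R := pi / (2 * n + 1)%:R) :
  (j <= n)%N -> [/\ 0 < a, 0 <= j%:R * a <= pi / 2 - a / 2 &
                   (0 < j)%N -> a <= j%:R * a].
Proof.
move=> jn; have m0 : 0 < (2 * n + 1)%:R :> R by rewrite ltr0n addn1.
have a0 : 0 < a by rewrite divr_gt0// pi_gt0.
have ma : (2 * n + 1)%:R * a = pi by rewrite mulrC divfK// gt_eqF.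
have -> : pi / 2 - a / 2 = n%:R * a by rewrite -ma natrD natrM; field.
split=> // [|j0]; first by rewrite mulr_ge0 ?(ltW a0)//= ler_pM2r// ler_nat.
by rewrite ler_peMl ?ler1n// ltW.
Qed.

Lemma tan_odd_prod (R : realType) (n : nat) (t : R) (a := pi / (2 * n + 1)%:R) :
  tan ((2 * n + 1)%:R * t) =
    tan t * \prod_(1 <= j < n.+1) (tan (j%:R * a + t) * tan (j%:R * a - t)).
Proof.
have [c c0 hs] := sin_odd_prod R n; have hc := cos_odd_prod hs.
rewrite {1}/tan hs hc -mulf_div -[c * sin t / _]mulf_div divff// mul1r; congr (_ * _).
rewrite -prodf_div; apply: eq_bigr => j _.
by rewrite -mulf_div.
Qed.

Lemma ln_tan_odd_sum (R : realType) (n : nat) (t : R)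
    (a := pi / (2 * n + 1)%:R) : 0 < t < a / 2 ->
  ln (tan ((2 * n + 1)%:R * t)) =
    ln (tan t) + \sum_(1 <= j < n.+1)
      (ln (tan (j%:R * a + t)) + ln (tan (j%:R * a - t))).
Proof.
move=> /andP[t0 ta].
have tt : 0 < tan t.
  have [a0 /andP[_ +] _] := @odd_step_bounds R n 0 isT; rewrite -/a in a0 * => h.
  by apply: tan_gt0_pihalf; lra.
have tj j : (1 <= j < n.+1)%N -> 0 < tan (j%:R * a + t) /\ 0 < tan (j%:R * a - t).
  move=> /andP[j0 jn]; have [a0 /andP[b1 b2]] := @odd_step_bounds R n j jn.
  rewrite -/a in a0 b1 b2 * => /(_ j0) aja.
  by split; apply: tan_gt0_pihalf; lra.
rewrite tan_odd_prod -/a big_nat_cond [in RHS]big_nat_cond.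
have : 0 < \prod_(1 <= j < n.+1 | (1 <= j < n.+1)%N && true)
    (tan (j%:R * a + t) * tan (j%:R * a - t)) /\
  ln (\prod_(1 <= j < n.+1 | (1 <= j < n.+1)%N && true)
    (tan (j%:R * a + t) * tan (j%:R * a - t))) =
  \sum_(1 <= j < n.+1 | (1 <= j < n.+1)%N && true)
    (ln (tan (j%:R * a + t)) + ln (tan (j%:R * a - t))).
  elim/big_ind2 : _ => [|x x' y y' [x0 <-] [y0 <-]|j /andP[/tj[p1 p2] _]].
  - by rewrite ln1.
  - by rewrite mulr_gt0// lnM.
  - by rewrite mulr_gt0// lnM.
by case=> p0 <-; rewrite lnM.
Qed.

(** * Integrability of ln tan *)

(** On a compact subinterval the integral of f is a difference of two values of
    F, hence at most 2 M; monotone convergence carries this bound over to the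
    whole interval, at whose ends f may be unbounded. *)
Lemma integrable_itvoo_bounded_primitive (R : realType) (f F : R -> R) (a b M : R) :
  (forall x : R, a < x < b -> is_derive x 1 F (f x)) ->
  (forall x : R, a < x < b -> {for x, continuous f}) ->
  (forall x : R, a < x < b -> 0 <= f x) ->
  (forall x : R, a < x < b -> `|F x| <= M) ->
  lebesgue_measure.-integrable `]a, b[ (EFin \o f).
Proof.
move=> dF cf f0 FM.
have [ba|ab] := leP b a.
  by rewrite set_itv_ge ?bnd_simp -?leNgt//; exact: integrable_set0.
(* k + 3 keeps a + e k < b - e k from the first index on *)
pose e (k : nat) := (b - a) / k.+3%:R.
pose E k : set R := `[a + e k, b - e k]%classic.
have e0 k : 0 < e k by rewrite divr_gt0// subr_gt0.
have e2 k : a + e k < b - e k.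
  have : e k < (b - a) / 2.
    by rewrite /e ltr_pM2l ?subr_gt0// ltf_pV2 ?posrE// ltr_nat.
  by lra.
have Eab k x : E k x -> a < x < b.
  by rewrite /E/= in_itv/= => /andP[? ?]; have := e0 k; lra.
have mE k : measurable (E k) by exact: measurable_itv.
have nnE : nondecreasing_seq E.
  apply/nondecreasing_seqP => n; rewrite subsetEset => x; rewrite /E/= !in_itv/=.
  have : e n.+1 <= e n.
    by rewrite /e ler_pM2l ?subr_gt0// lef_pV2 ?posrE// ler_nat.
  by move=> ? /andP[? ?]; lra.
have UE : \bigcup_k E k = `]a, b[%classic.
  apply/seteqP; split => x /=; first by case=> k _ /Eab; rewrite in_itv.
  rewrite in_itv/= => /andP[ax xb].
  pose y := Num.min (x - a) (b - x).
  have y0 : 0 < y by rewrite lt_min !subr_gt0 ax xb.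
  pose k := Num.bound ((b - a) / y).
  have ek : e k <= y.
    rewrite /e ler_pdivrMr// mulrC -ler_pdivrMr//.
    have : (b - a) / y < k%:R.
      by apply: archi_boundP; rewrite divr_ge0 ?(ltW y0)// subr_ge0 ltW.
    by move=> /ltW/le_trans; apply; rewrite ler_nat -addn3 leq_addr.
  exists k => //; rewrite /E/= in_itv/=; move: ek; rewrite le_min.
  by move=> /andP[? ?]; apply/andP; split; lra.
have mf : measurable_fun `]a, b[ f.
  apply: open_continuous_measurable_fun => // x.
  by rewrite inE/= in_itv/=; exact: cf.
have intE k : (\int[lebesgue_measure]_(x in E k) (f x)%:E =
               (F (b - e k) - F (a + e k))%:E)%E.
  rewrite EFinB.
  have Fc x : x \in `[a + e k, b - e k] -> {for x, continuous F}.
    move=> /Eab/dF[dx _].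
    by apply: differentiable_continuous; exact/derivable1_diffP.
  apply: continuous_FTC2 => //.
  - apply: continuous_in_subspaceT => x; rewrite inE => /Eab; exact: cf.
  - split=> [x xE||].
    + by have [] := dF _ (@Eab k x (subset_itv_oo_cc xE)).
    + by apply: cvg_at_right_filter; apply: Fc; rewrite in_itv/= lexx ltW.
    + by apply: cvg_at_left_filter; apply: Fc; rewrite in_itv/= lexx ltW.
  - move=> x xE; rewrite derive1E.
    by have [_ ->] := dF _ (@Eab k x (subset_itv_oo_cc xE)).
apply/integrableP; split; first exact/measurable_EFinP.
have -> : (\int[lebesgue_measure]_(x in `]a, b[) `|(EFin \o f) x| =
           \int[lebesgue_measure]_(x in \bigcup_k E k) (f x)%:E)%E.
  rewrite UE; apply: eq_integral => x; rewrite inE/= in_itv/= => /f0 fx.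
  by rewrite /= ger0_norm.
apply: (@le_lt_trans _ _ (M + M)%:E); last exact: ltry.
have cvgE : (\int[lebesgue_measure]_(x in E k) (f x)%:E @[k --> \oo] -->
            \int[lebesgue_measure]_(x in \bigcup_i E i) (f x)%:E)%E.
  apply: ge0_nondecreasing_set_cvg_integral => // i.
  - by apply/measurable_EFinP; apply: measurable_funS mf => // x /Eab; rewrite /= in_itv.
  - by move=> x /Eab/f0; rewrite lee_fin.
rewrite -(cvg_lim _ cvgE)//; apply: lime_le; first by apply/cvg_ex; eexists; exact: cvgE.
apply: nearW => k; rewrite intE lee_fin.
have := FM (b - e k); have := FM (a + e k).
rewrite !ler_norml; have := e0 k; have := e2 k => h1 h2 h3 h4.
have /h3/andP[? ?] : a < a + e k < b by apply/andP; split; lra.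
have /h4/andP[? ?] : a < b - e k < b by apply/andP; split; lra.
lra.
Qed.

(** By ln y < y at y = u / v and at y = v / u, the left side is at most
    2 (u ^ 2 + v ^ 2) / (u v) <= 4 / (u v), whereas the right side is
    4 (u ^ 3 + v ^ 3) / (u v) with u ^ 3 + v ^ 3 >= u ^ 4 + v ^ 4 = 1. *)
Lemma norm_ln_sqr_div_le (R : realType) (u v : R) :
  0 < u <= 1 -> 0 < v <= 1 -> (v ^+ 2) ^+ 2 + (u ^+ 2) ^+ 2 = 1 ->
  `|ln (u ^+ 2 / v ^+ 2)| <= 4 * (v ^+ 2 / u + u ^+ 2 / v).
Proof.
move=> /andP[u0 u1] /andP[v0 v1] uv1.
rewrite -expr_div_n lnXn ?divr_gt0// normrMn -[leLHS]mulr_natl.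
have le1 : `|ln (u / v)| <= u / v + v / u.
  have l1 := ln_sublinear (divr_gt0 u0 v0).
  have l2 := ln_sublinear (divr_gt0 v0 u0).
  rewrite -[v / u]invf_div lnV ?posrE ?divr_gt0// invf_div in l2.
  have := divr_gt0 u0 v0; have := divr_gt0 v0 u0.
  by rewrite ler_norml => ? ?; apply/andP; split; lra.
apply: (@le_trans _ _ (2 * (u / v + v / u))); first by rewrite ler_pM2l.
have -> : u / v + v / u = (u ^+ 2 + v ^+ 2) / (u * v).
  by field; rewrite !gt_eqF.
have -> : v ^+ 2 / u + u ^+ 2 / v = (v ^+ 3 + u ^+ 3) / (u * v).
  by field; rewrite !gt_eqF.
rewrite !mulrA ler_pM2r ?invr_gt0 ?mulr_gt0//.
have u3 : u ^+ 4 <= u ^+ 3 by rewrite exprS ler_piMl// exprn_ge0// ltW.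
have v3 : v ^+ 4 <= v ^+ 3 by rewrite exprS ler_piMl// exprn_ge0// ltW.
have u2 : u ^+ 2 <= 1 by rewrite exprn_ile1// ltW.
have v2 : v ^+ 2 <= 1 by rewrite exprn_ile1// ltW.
by move: uv1; rewrite -!exprM /= => ?; lra.
Qed.

(** This majorant of ln tan is the derivative of
    8 (sqrt (sin x) - sqrt (cos x)). *)
Lemma norm_ln_tan_le (R : realType) (x : R) : 0 < x < pi / 2 ->
  `|ln (tan x)| <=
    4 * (cos x / Num.sqrt (sin x) + sin x / Num.sqrt (cos x)).
Proof.
move=> /sin_cos_gt0[s0 c0].
have := @norm_ln_sqr_div_le R (Num.sqrt (sin x)) (Num.sqrt (cos x)).
rewrite !sqr_sqrtr ?(ltW s0) ?(ltW c0)//; apply; last exact: cos2Dsin2.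
- by rewrite sqrtr_gt0 s0 -sqrtr1 ler_wsqrtr// sin_le1.
- by rewrite sqrtr_gt0 c0 -sqrtr1 ler_wsqrtr// cos_le1.
Qed.

Lemma continuous_ln_tan (R : realType) (x : R) : 0 < x < pi / 2 ->
  {for x, continuous (fun y => ln (tan y))}.
Proof.
move=> x0p; apply: continuous_comp.
  by apply: continuous_tan; have [_ c0] := sin_cos_gt0 x0p; rewrite gt_eqF.
by apply: continuous_ln; exact: tan_gt0_pihalf.
Qed.

Lemma integrable_ln_tan (R : realType) :
  lebesgue_measure.-integrable `]0, (pi / 2 : R)[ (EFin \o (fun x => ln (tan x))).
Proof.
pose G (x : R) := 4 * (cos x / Num.sqrt (sin x) + sin x / Num.sqrt (cos x)).
have mf : measurable_fun `]0, (pi / 2 : R)[ (fun x => ln (tan x)).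
  apply: open_continuous_measurable_fun => // x.
  by rewrite inE/= in_itv/=; exact: continuous_ln_tan.
suff iG : lebesgue_measure.-integrable `]0, (pi / 2 : R)[ (EFin \o G).
  apply: le_integrable iG => //=.
  - exact/measurable_EFinP.
  - move=> x; rewrite /= in_itv/= => /norm_ln_tan_le h.
    by rewrite lee_fin (le_trans h)// ler_norm.
apply: (@integrable_itvoo_bounded_primitive _ G
  (fun x => 8 * (Num.sqrt (sin x) - Num.sqrt (cos x))) _ _ 16).
- move=> x /sin_cos_gt0[s0 c0].
  have := is_derive1_sqrt s0; have := is_derive1_sqrt c0 => ? ?.
  apply: is_derive_eq; rewrite /G /GRing.scale/=.
  by field; rewrite !gt_eqF ?sqrtr_gt0.
- move=> x /sin_cos_gt0[s0 c0]; rewrite /G.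
  have cs : {for x, continuous (fun y => (Num.sqrt (sin y))^-1)}.
    apply: continuousV; first by rewrite gt_eqF// sqrtr_gt0.
    by apply: continuous_comp; [exact: continuous_sin|exact: sqrt_continuous].
  have cc : {for x, continuous (fun y => (Num.sqrt (cos y))^-1)}.
    apply: continuousV; first by rewrite gt_eqF// sqrtr_gt0.
    by apply: continuous_comp; [exact: continuous_cos|exact: sqrt_continuous].
  apply: continuousM; first exact: cst_continuous.
  apply: continuousD; apply: continuousM => //.
    exact: continuous_cos.
  exact: continuous_sin.
- move=> x /sin_cos_gt0[s0 c0]; rewrite /G.
  by rewrite mulr_ge0// addr_ge0// divr_ge0 ?sqrtr_ge0// ltW.
- move=> x /sin_cos_gt0[s0 c0].
  have su : Num.sqrt (sin x) <= 1 by rewrite -sqrtr1 ler_wsqrtr// sin_le1.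
  have cu : Num.sqrt (cos x) <= 1 by rewrite -sqrtr1 ler_wsqrtr// cos_le1.
  have := sqrtr_ge0 (sin x); have := sqrtr_ge0 (cos x).
  by rewrite ler_norml => ? ?; apply/andP; split; lra.
Qed.

(** * The primitive of ln tan *)

(** Starting the integral at -1 and extending the integrand by zero makes 0 and
    pi / 2 interior points, so that continuity there is two-sided. *)
Definition ln_tan_primitive (R : realType) (x : R) : R :=
  parameterized_integral lebesgue_measure (-1) x
    ((fun t => ln (tan t)) \_ `]0, (pi / 2 : R)[).

Lemma ln_tan_primitiveE (R : realType) (r : R) : 0 <= r <= 1 / 2 ->
  T r = ln_tan_primitive (r * pi).
Proof.
move=> /andP[r0 r1].
rewrite /T /ln_tan_primitive /parameterized_integral.
rewrite Rintegral_mkcond [RHS]Rintegral_mkcond; apply: eq_Rintegral => x _.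
have p0 := pi_gt0 R.
have rp : r * pi <= pi / 2 by nra.
rewrite !patchE !mem_setE !in_itv/=.
(* at the endpoints the integrand of T is ln 0 = 0, as is the extension *)
have [->|x0] := eqVneq x 0.
  by rewrite tan0 ln0// !if_same.
have [->|xp] := eqVneq x (pi / 2).
  by rewrite tan_pihalf ln0// !if_same.
have [xr|xr] := leP x (r * pi); last by rewrite !andbF.
have xp2 : x < pi / 2 by rewrite lt_neqAle xp (le_trans xr).
rewrite xp2 !andbT le_eqVlt eq_sym (negbTE x0)/=.
by case: ltP => [x1|_]; rewrite ?if_same// ifT// (le_trans _ (ltW x1))// oppr_le0.
Qed.

Lemma integrable_patch_ln_tan (R : realType) (x : R) :
  lebesgue_measure.-integrable `[-1, x]
    (EFin \o ((fun t => ln (tan t)) \_ `]0, (pi / 2 : R)[)).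
Proof.
have := integrable_ln_tan R; rewrite integrable_mkcond//.
by rewrite restrict_EFin; exact: integrableS.
Qed.

Lemma continuous_ln_tan_primitive (R : realType) (x : R) : 0 <= x <= pi / 2 ->
  {for x, continuous (@ln_tan_primitive R)}.
Proof.
move=> /andP[x0 xp]; have p0 := pi_gt0 R.
have := parameterized_integral_continuous _ (@integrable_patch_ln_tan R pi).
have lt1p : -1 < pi :> R by lra.
move=> /(_ (ltW lt1p))/(continuous_within_itvP _ lt1p)[+ _ _].
by apply; rewrite in_itv/=; apply/andP; split; lra.
Qed.

Lemma is_derive_ln_tan_primitive (R : realType) (x : R) : 0 < x < pi / 2 ->
  is_derive x 1 (@ln_tan_primitive R) (ln (tan x)).
Proof.
move=> x0p; pose g := (fun t : R => ln (tan t)) \_ `]0, (pi / 2 : R)[.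
have ge t : 0 < t < pi / 2 -> g t = ln (tan t).
  by move=> t0p; rewrite /g patchE mem_setE in_itv/= t0p.
have cg : {for x, continuous g}.
  rewrite /prop_for /continuous_at ge//.
  apply: cvg_trans (continuous_ln_tan x0p); apply: near_eq_cvg.
  have : \forall t \near x, t \in `]0, (pi / 2 : R)[.
    by apply: near_in_itvoo; rewrite in_itv.
  by apply: filterS => t; rewrite in_itv/= => /ge.
case/andP: (x0p) => x0 xp; have p0 := pi_gt0 R.
have [] := @continuous_FTC1_closed R g (-1) x pi _ (@integrable_patch_ln_tan R pi) _ cg.
- by lra.
- by lra.
- move=> dV Vg; apply: DeriveDef; first exact: dV.
  by rewrite -derive1E -ge// -Vg.
Qed.

(** * The multiplication formula *)

Lemma is_derive_bigsum (R : realType) (I : eqType) (s : seq I) (h : I -> R -> R)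
    (dh : I -> R) (x : R) :
  {in s, forall i, is_derive x 1 (h i) (dh i)} ->
  is_derive x 1 (fun t => \sum_(i <- s) h i t) (\sum_(i <- s) dh i).
Proof.
elim: s => [|i s ih] hs.
  under eq_fun do rewrite big_nil.
  by rewrite big_nil; exact: is_derive_cst.
under eq_fun do rewrite big_cons.
rewrite big_cons; apply: is_deriveD; first by apply: hs; rewrite mem_head.
by apply: ih => j js; apply: hs; rewrite in_cons js orbT.
Qed.

Lemma continuous_bigsum (R : realType) (I : eqType) (s : seq I) (h : I -> R -> R)
    (x : R) :
  {in s, forall i, {for x, continuous (h i)}} ->
  {for x, continuous (fun t => \sum_(i <- s) h i t)}.
Proof.
rewrite /prop_for /continuous_at; elim: s => [|i s ih] hs.
  under eq_fun do rewrite big_nil.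
  by rewrite big_nil; exact: cvg_cst.
under eq_fun do rewrite big_cons.
rewrite big_cons; apply: cvgD; first by apply: hs; rewrite mem_head.
by apply: ih => j js; apply: hs; rewrite in_cons js orbT.
Qed.

Theorem theorem4 (R : realType) (m n : nat) (hm : m = (2 * n + 1)%N)
    (r : R) (hr0 : 0 <= r) (hr1 : r <= 1 / (2 * m%:R)) :
  T (m%:R * r) =
    m%:R * (\sum_(0 <= j < n.+1) T (j%:R / m%:R + r))
    - m%:R * (\sum_(1 <= j < n.+1) T (j%:R / m%:R - r)).
Proof.
have p0 := pi_gt0 R.
have m0 : 0 < m%:R :> R by rewrite ltr0n hm addn1.
pose a : R := pi / m%:R.
have a0 : 0 < a by rewrite divr_gt0.
have ma : m%:R * a = pi by rewrite mulrC divfK// gt_eqF.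
have t1 : r * pi <= a / 2.
  have -> : a / 2 = 1 / (2 * m%:R) * pi by rewrite /a; field; rewrite gt_eqF.
  by rewrite ler_pM2r.
have t0 : 0 <= r * pi by rewrite mulr_ge0// ltW.
have ja j : (j <= n)%N -> 0 <= j%:R * a <= pi / 2 - a / 2.
  by move=> jn; have [_ + _] := @odd_step_bounds R n j jn; rewrite -hm.
have ja1 j : (0 < j)%N -> (j <= n)%N -> a <= j%:R * a.
  by move=> j0 jn; have [_ _ /(_ j0)] := @odd_step_bounds R n j jn; rewrite -hm.
have ap : a / 2 <= pi / 2 by have /andP[] := ja 0 (leq0n n); lra.
pose V := @ln_tan_primitive R.
have TV x : 0 <= x * pi <= pi / 2 -> T x = V (x * pi).
  move=> /andP[x0 x1]; apply: ln_tan_primitiveE.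
  by move: x0 x1; rewrite pmulr_lge0// => -> h; rewrite -(ler_pM2r p0); lra.
have jn1 j : (j \in index_iota 1 n.+1) = (0 < j)%N && (j <= n)%N.
  by rewrite mem_index_iota.
pose K j t := V (j%:R * a + t) - V (j%:R * a - t).
(* the difference of the two sides at t = r pi *)
pose D t := V (m%:R * t) - m%:R * (V t + \sum_(1 <= j < n.+1) K j t).
have V0 : V 0 = 0.
  have := TV 0; rewrite mul0r lexx divr_ge0 ?(ltW p0)// => /(_ isT) <-.
  by rewrite /T mul0r set_itv1 Rintegral_set1.
have D0 : D 0 = 0.
  rewrite /D mulr0 V0 big1 ?addr0 ?mulr0 ?subrr// => j _.
  by rewrite /K addr0 subr0 subrr.
suff Dt : D (r * pi) = 0.
  move/eqP: Dt; rewrite subr_eq0 mulrA -TV; last first.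
    by rewrite -mulrA; move: ma t0 t1; nra.
  move=> /eqP ->; rewrite -mulrBr; congr (_ * _).
  rewrite [\sum_(0 <= j < n.+1) _]big_ltn// mul0r add0r -TV; last by apply/andP; split; lra.
  rewrite -addrA; congr (_ + _); rewrite -sumrB.
  apply: eq_big_nat => j /andP[j0 jn].
  have e : j%:R / m%:R * pi = j%:R * a by rewrite /a mulrAC mulrA.
  have := ja j jn; have := ja1 j j0 jn => h1 /andP[h2 h3].
  have e1 : (j%:R / m%:R + r) * pi = j%:R * a + r * pi by rewrite [LHS]mulrDl e.
  have e2 : (j%:R / m%:R - r) * pi = j%:R * a - r * pi by rewrite [LHS]mulrBl e.
  by rewrite !TV ?e1 ?e2//; apply/andP; split; lra.
have dV x : 0 < x < pi / 2 -> is_derive x 1 V (ln (tan x)).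
  exact: is_derive_ln_tan_primitive.
have cV x : 0 <= x <= pi / 2 -> {for x, continuous V}.
  exact: continuous_ln_tan_primitive.
have dD x : x \in `]0, r * pi[ -> is_derive x 1 D 0.
  rewrite in_itv/= => /andP[x0 xr].
  have xa : x < a / 2 by lra.
  pose dK j := ln (tan (j%:R * a + x)) + ln (tan (j%:R * a - x)).
  have dKj : {in index_iota 1 n.+1, forall j, is_derive x 1 (K j) (dK j)}.
    move=> j; rewrite jn1 => /andP[j0 jn].
    have := ja j jn; have := ja1 j j0 jn => h1 /andP[h2 h3].
    have d1 : is_derive (j%:R * a + x) 1 V (ln (tan (j%:R * a + x))).
      by apply: dV; apply/andP; split; lra.
    have d2 : is_derive (j%:R * a - x) 1 V (ln (tan (j%:R * a - x))).
      by apply: dV; apply/andP; split; lra.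
    rewrite /K; apply: is_derive_eq.
    by rewrite /dK; ring.
  have dS := is_derive_bigsum dKj.
  have d1 : is_derive (m%:R * x) 1 V (ln (tan (m%:R * x))).
    apply: dV; rewrite mulr_gt0//=; move: ma xa m0; nra.
  have d2 : is_derive x 1 V (ln (tan x)).
    apply: dV; apply/andP; split; lra.
  apply: is_derive_eq.
  have E : ln (tan (m%:R * x)) = ln (tan x) + \sum_(1 <= j < n.+1) dK j.
    by have := @ln_tan_odd_sum R n x; rewrite /= -hm; apply; rewrite x0.
  by rewrite E /GRing.scale/= mulr1 mulrC subrr.
have cVD (f : R -> R) x : {for x, continuous f} -> 0 <= f x <= pi / 2 ->
    {for x, continuous (V \o f)}.
  by move=> cf fx; apply: continuous_comp cf _; exact: cV.
have cD x : x \in `[0, r * pi] -> {for x, continuous D}.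
  rewrite in_itv/= => /andP[x0 xr].
  have cid : {for x, continuous (@id R)} by exact: cvg_id.
  have cK : {in index_iota 1 n.+1, forall j, {for x, continuous (K j)}}.
    move=> j; rewrite jn1 => /andP[j0 jn].
    have := ja j jn; have := ja1 j j0 jn => h1 /andP[h2 h3].
    apply: continuousB; apply: cVD.
    - by apply: continuousD => //; exact: cvg_cst.
    - by apply/andP; split; lra.
    - by apply: continuousB => //; exact: cvg_cst.
    - by apply/andP; split; lra.
  apply: continuousB.
    apply: cVD; first by apply: continuousM => //; exact: cvg_cst.
    by rewrite mulr_ge0 ?(ltW m0)//=; move: ma m0; nra.
  apply: continuousM; first exact: cvg_cst.
  apply: continuousD; first by apply: cV; apply/andP; split; lra.
  exact: continuous_bigsum.
have [|c _] := @MVT_segment R D (fun=> 0) 0 (r * pi) t0 dD.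
- by apply: continuous_in_subspaceT => x; rewrite inE; exact: cD.
- by rewrite D0 subr0 mul0r.
Qed.
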